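(* There exist absolute constants $\varepsilon_0>0$ and $C>0$ such that for all integers $k\ge1$ and $d>2k$, every linear map $A:\mathbb{R}^d\to\mathbb{R}^k$, and every $0<\varepsilon<\varepsilon_0$, if $x$ is a uniformly random vector on the unit sphere $S^{d-1}$, then $$\Pr_x\big[\,|\|Ax\|_2^2-1|>\varepsilon\,\big]\ge \exp\big(-C(k\varepsilon^2+1)\big).$$ *)

(* Defs.v *)
From HB Require Import structures.
From mathcomp Require Import all_boot all_order all_algebra.
From mathcomp Require Import all_classical all_reals all_analysis.

Set Implicit Arguments.
Unset Strict Implicit.
Unset Printing Implicit Defensive.

Import Order.TTheory GRing.Theory Num.Theory.
Import numFieldNormedType.Exports.

Local Open Scope classical_set_scope.
Local Open Scope ring_scope.

(* The library's `|x| on 'rV[R]_n is the sup norm, hence this definition. *)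
Definition l2norm (R : realType) (n : nat) (x : 'rV[R]_n) : R :=
  Num.sqrt (\sum_(i < n) x ord0 i ^+ 2).

Definition unit_sphere (R : realType) (n : nat) : set 'rV[R]_n :=
  [set x | l2norm x = 1].

Definition orthogonal_mx (R : realType) (n : nat) (Q : 'M[R]_n) : Prop :=
  Q *m Q^T = 1%:M.

Definition borel_rV (R : realType) (n : nat) : measurableType _ :=
  g_sigma_algebraType (@open 'rV[R]_n).

(* The uniform distribution on the sphere is the unique Borel probability
   measure carried by the sphere and invariant under the orthogonal group. *)
Definition uniform_on_sphere (R : realType) (n : nat)
    (mu : probability (borel_rV R n) R) : Prop :=
  mu (@unit_sphere R n) = 1%E /\
  forall Q : 'M[R]_n, orthogonal_mx Q ->
  forall B : set 'rV[R]_n, measurable (B : set (borel_rV R n)) ->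
    mu ((fun x : 'rV[R]_n => x *m Q) @^-1` B) = mu B.

(* Main.v *)
Require Import Defs.
From mathcomp Require Import all_boot all_order all_algebra.
From mathcomp Require Import fingroup perm spectral complex.
From mathcomp Require Import all_classical all_reals all_analysis.
From mathcomp Require Import measurable_realfun ring lra.

(* After an orthogonal change of coordinates [|Av|^2 = sum_i l_i v_i^2] with at
   most [k] nonzero weights, so each weighted coordinate [x_i = v_i] can be paired
   with an unweighted one [y_i = v_(k+i)]. Only the orthogonal invariance of the
   law of [v] is used: reflecting every plane [(x_i, y_i)] and then flipping the
   signs of the [y_i] replaces [|Av|^2] by
     [sum_i l_i ((3 x_i + 4 e_i y_i) / 5)^2 = M + sum_i e_i b_i],
   with [b_i = 24/25 l_i x_i y_i] and uniform independent signs [e_i]. With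
   probability at least [1/2] the sum of the [|b_i|] is comparable to
   [sum_i l_i (x_i^2 + y_i^2)]. If the latter is below [15/16], [|Av|^2] is too
   small for every choice of signs; otherwise the sum of the [|b_i|] is at least
   [1/16], and a change of measure on the sign cube shows that the signed sum
   leaves [-eps, eps], on a prescribed side, with probability at least
   [exp(-O(k eps^2 + 1))]. *)

Set Implicit Arguments.
Unset Strict Implicit.
Unset Printing Implicit Defensive.

Import Order.TTheory GRing.Theory Num.Theory.
Import numFieldNormedType.Exports.

Local Open Scope ring_scope.

(** * Orthogonal diagonalization of real symmetric matrices *)

Lemma mulmx_trE (R : pzRingType) n (u v : 'rV[R]_n) :
  (u *m v^T) 0 0 = \sum_i u 0 i * v 0 i.
Proof. by rewrite mxE; apply: eq_bigr => i _; rewrite mxE. Qed.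

Lemma mulmx_tr_eq0 (R : realDomainType) n (u : 'rV[R]_n) :
  (u *m u^T == 0) = (u == 0).
Proof.
apply/eqP/eqP => [u0|->]; last by rewrite mul0mx.
have /eqP : (u *m u^T) 0 0 = 0 by rewrite u0 mxE.
rewrite mulmx_trE psumr_eq0 => [/allP z|i _]; last exact: sqr_ge0.
apply/rowP => i; rewrite mxE.
by have /implyP/(_ isT) := z i (mem_index_enum i); rewrite mulf_eq0 orbb => /eqP.
Qed.

(** Over the complex closure there is an eigenvalue [a] with an eigenvector [v]. With [w] the
    conjugate transpose of [v], the scalar [v *m Mc *m w] is [a] times the squared norm of [v]; it
    is its own conjugate because [M] is real and symmetric. Hence [a] is real, and it is a root of
    the characteristic polynomial of [M] itself. *)
Lemma symmetric_eigenvalue (R : rcfType) n (M : 'M[R]_n.+1) :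
  M^T = M -> exists l, eigenvalue M l.
Proof.
move=> sM; pose Mc := map_mx (real_complex R) M.
have [a /[dup] aM /eigenvalueP[v vM v0]] := @eigenvalue_closed _ _ Mc isT.
pose w := (map_mx (@Num.conj _) v)^T; pose S := (v *m w) 0 0.
have SE : S = \sum_i `|v 0 i| ^+ 2.
  by rewrite /S mxE; apply: eq_bigr => i _; rewrite !mxE normCK.
have S0 : S != 0.
  apply: contra_neq v0 => S0; apply/rowP => i; rewrite mxE.
  move/eqP: S0; rewrite SE psumr_eq0 => [/allP z|j _]; last exact: exprn_ge0.
  have /implyP/(_ isT) := z i (mem_index_enum i).
  by rewrite expf_eq0 normr_eq0 => /eqP.
have cS : (S^* )%R = S.
  by rewrite SE rmorph_sum; apply: eq_bigr => i _; rewrite rmorphXn /= conj_normC.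
have aSE : (v *m Mc *m w) 0 0 = a * S by rewrite vM -scalemxAl mxE.
have cMc : map_mx (@Num.conj _) Mc = Mc.
  by apply/matrixP => i j; rewrite !mxE; exact: conjc_real.
have caS : ((a * S)^* )%R = a * S.
  have cw : map_mx (@Num.conj _) w = v^T.
    by apply/matrixP => i j; rewrite !mxE conjCK.
  transitivity ((map_mx (@Num.conj _) (v *m Mc *m w)) 0 0).
    by rewrite [RHS]mxE aSE.
  rewrite !map_mxM cMc cw -aSE.
  have -> : (v *m Mc *m w) 0 0 = (v *m Mc *m w)^T 0 0 by rewrite [RHS]mxE.
  have McT : Mc^T = Mc by rewrite /Mc -{2}sM map_trmx.
  by rewrite !trmx_mul trmxK McT mulmxA.
have ra : a \is Num.real.
  by apply/CrealP; apply: (mulIf S0); rewrite -[LHS]/(_ * _) -{1}cS -rmorphM.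
have /complex_realP[l al] := ra.
exists l; rewrite eigenvalue_root_char -(fmorph_root (real_complex R)).
by rewrite map_char_poly -eigenvalue_root_char; move: aM; rewrite al.
Qed.

Lemma symmetric_unit_eigenvector (R : rcfType) n (M : 'M[R]_n.+1) :
  M^T = M -> exists (u : 'rV[R]_n.+1) l, u *m u^T = 1%:M /\ u *m M = l *: u.
Proof.
move=> /symmetric_eigenvalue[l /eigenvalueP[v vM v0]].
pose s := (v *m v^T) 0 0.
have s_ge0 : 0 <= s by rewrite /s mulmx_trE sumr_ge0 // => i _; exact: sqr_ge0.
have s_neq0 : s != 0.
  apply: contra v0 => /eqP s0; rewrite -mulmx_tr_eq0.
  by apply/eqP/matrixP => i j; rewrite !ord1 [LHS]s0 mxE.
exists ((Num.sqrt s)^-1 *: v), l; split; last by rewrite -scalemxAl vM !scalerA mulrC.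
rewrite linearZ /= -scalemxAl -scalemxAr scalerA.
apply/matrixP => i j; rewrite !ord1 [LHS]mxE -/s [RHS]mxE eqxx mulr1n.
by rewrite -invfM -expr2 sqr_sqrtr // mulVf.
Qed.

(** Unless [u] is already the first basis vector [e], the Householder reflection along [w = u - e]
    sends [e] to [u], so its first row is [u]. The key identity is [|u - e|^2 = 2 - 2 <e, u>]. *)
Lemma orthogonal_completion (R : rcfType) n (u : 'rV[R]_n.+1) :
  u *m u^T = 1%:M ->
  exists2 Q : 'M[R]_n.+1, Q *m Q^T = 1%:M & row 0 Q = u.
Proof.
move=> uu; pose e : 'rV[R]_n.+1 := delta_mx 0 0.
have ee : e *m e^T = 1%:M.
  rewrite trmx_delta mul_delta_mx; apply/matrixP => i j.
  by rewrite !ord1 !mxE eqxx.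
have [w wE] : exists w, w = u - e by exists (u - e).
have [w0|w0] := eqVneq w 0.
  exists 1%:M; first by rewrite trmx1 mulmx1.
  by move/eqP: w0; rewrite wE subr_eq0 => /eqP ->; rewrite row1.
pose s := (w *m w^T) 0 0; pose c := (e *m u^T) 0 0.
have wwE : w *m w^T = s%:M by exact: mx11_scalar.
have s0 : s != 0.
  apply: contra w0 => /eqP s0; rewrite -mulmx_tr_eq0 wwE s0.
  by apply/eqP/matrixP => i j; rewrite !mxE mul0rn.
have eu : e *m u^T = c%:M by exact: mx11_scalar.
have ue : u *m e^T = c%:M by rewrite -[u]trmxK -trmx_mul eu tr_scalar_mx.
have ew : e *m w^T = (c - 1)%:M.
  by rewrite wE linearB /= mulmxBr eu ee (raddfB (@scalar_mx R 1)).
have sE : s = 2 - 2 * c.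
  have : s%:M = (2 - 2 * c)%:M :> 'M[R]_1.
    rewrite -wwE {1}wE mulmxBl ew wE linearB /= mulmxBr uu ue.
    by rewrite -!(raddfB (@scalar_mx R 1)) /=; congr (_%:M); ring.
  by move=> /matrixP/(_ 0 0); rewrite !mxE eqxx !mulr1n.
pose P := w^T *m w; pose H := 1%:M - (2 / s) *: P.
have PP : P *m P = s *: P.
  by rewrite /P mulmxA -(mulmxA w^T) wwE mul_mx_scalar -scalemxAl.
exists H.
  rewrite linearB /= trmx1 linearZ /= /P trmx_mul trmxK -/P.
  rewrite mulmxBl mul1mx mulmxBr mulmx1 -scalemxAl -scalemxAr PP !scalerA.
  rewrite -scalerBl -addrA -opprD -scalerDl.
  have -> : 2 / s + (2 / s - 2 / s * (2 / s) * s) = 0 by field.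
  by rewrite scale0r subr0.
rewrite rowE mulmxBr mulmx1 -/e -scalemxAr /P mulmxA ew mul_scalar_mx scalerA.
have -> : 2 / s * (c - 1) = -1.
  by apply: (mulIf s0); rewrite mulrAC divfK // sE; ring.
by rewrite wE scaleN1r opprK addrC subrK.
Qed.

(** Induction on the size. Conjugating by an orthogonal matrix whose first row is a unit eigenvector
    clears the rest of the first row, hence by symmetry the rest of the first column; the induction
    hypothesis handles the remaining block. *)
Lemma symmetric_diagonalizable (R : rcfType) n (M : 'M[R]_n) :
  M^T = M ->
  exists (Q : 'M[R]_n) d, Q *m Q^T = 1%:M /\ Q *m M *m Q^T = diag_mx d.
Proof.
elim: n M => [|n IHn] M sM.
  by exists 1%:M, 0; split; apply/matrixP => -[].
have [u [l [uu uM]]] := symmetric_unit_eigenvector sM.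
have [Q QQ Qu] := orthogonal_completion uu.
pose N : 'M[R]_(1 + n) := Q *m M *m Q^T.
have sN : N^T = N by rewrite /N !trmx_mul trmxK sM mulmxA.
have rN : row 0 N = l *: delta_mx 0 0.
  by rewrite !row_mul Qu uM -scalemxAl -Qu -row_mul QQ row1.
have urN : ursubmx N = 0.
  apply/matrixP => i j; rewrite !mxE !ord1 /=.
  have /rowP/(_ (rshift 1 j)) := rN.
  by rewrite !mxE lshift0 => ->; rewrite eqxx /= mulr0.
have dlN : dlsubmx N = 0 by rewrite -trmx0 -urN trmx_ursub sN.
have [Q' [d [QQ' Qd]]] := IHn (drsubmx N) ltac:(by rewrite trmx_drsub sN).
pose L : 'M[R]_(1 + n) := block_mx 1%:M 0 0 Q'.
have LT : L^T = block_mx 1%:M 0 0 Q'^T by rewrite /L tr_block_mx !trmx0 trmx1.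
have LL : L *m L^T = 1%:M.
  rewrite LT mulmx_block !mulmx0 !mul0mx !addr0 !add0r mulmx1 QQ'.
  by rewrite -scalar_mx_block.
have LNL : L *m N *m L^T = diag_mx (row_mx (ulsubmx N) d).
  rewrite -[N in LHS]submxK urN dlN LT !mulmx_block.
  rewrite !mulmx0 !mul0mx !addr0 !add0r !mulmx1 !mul1mx Qd !mul0mx diag_mx_row.
  by congr block_mx; apply/matrixP => i j; rewrite !ord1 [RHS]mxE eqxx mulr1n.
exists (L *m Q), (row_mx (ulsubmx N) d); split.
  by rewrite trmx_mul mulmxA -(mulmxA L) QQ mulmx1.
by rewrite -LNL trmx_mul /N !mulmxA.
Qed.

(** * Diagonal form of the squared norm, with the nonzero weights in front *)

(** The submatrix indexed by the nonzero entries is diagonal and invertible, and a submatrix has at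
    most the rank of the whole. *)
Lemma card_diag_mx_rank (F : fieldType) n (d : 'rV[F]_n) :
  (#|[set i | (d 0 i != 0)%R]| <= \rank (diag_mx d))%N.
Proof.
set S := finset _; pose f (i : 'I_#|S|) := enum_val i.
have dS : mxsub f f (diag_mx d) = diag_mx (colsub f d).
  by apply/matrixP => i j; rewrite !mxE (inj_eq enum_val_inj).
have <- : \rank (diag_mx (colsub f d)) = #|S|.
  apply/eqP; rewrite mxrank_unit // unitmxE unitfE det_diag prodf_seq_neq0.
  apply/allP => i _ /=; rewrite mxE.
  by have := enum_valP i; rewrite inE.
rewrite -dS mxsubrc (leq_trans (mxrankS (rowsub_sub _ _))) //.
by rewrite -mxrank_tr trmx_mxsub (leq_trans (mxrankS (rowsub_sub _ _))) ?mxrank_tr.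
Qed.

Lemma perm_to_front n (S : {set 'I_n}) :
  exists s : 'S_n, forall i, s i \in S -> (i < #|S|)%N.
Proof.
have sz : size (enum S ++ enum (~: S)) == n.
  by rewrite size_cat -!cardE cardsC card_ord.
pose t := Tuple sz.
have tI : injective (tnth t).
  apply/tuple_uniqP; rewrite /= cat_uniq !enum_uniq andbT /=.
  by apply/hasPn => i; rewrite !mem_enum inE.
exists (perm tI) => i; rewrite permE (tnth_nth i) /= nth_cat -cardE.
case: ltnP => // Si; set j := nth _ _ _ => jS.
suff : j \in enum (~: S) by rewrite mem_enum inE jS.
by rewrite mem_nth // -cardE ltn_subLR // cardsC card_ord.
Qed.

(** The weights are the eigenvalues of [a *m a^T]. They are squared norms of the rows of [Q *m a],
    hence nonnegative, and at most [k] of them are nonzero since the rank is at most [k]; a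
    permutation matrix moves those to the front. *)
Lemma quadratic_form_diagonalizable (R : rcfType) d k (a : 'M[R]_(d, k)) :
  exists (Q : 'M[R]_d) (l : 'I_d -> R),
  [/\ Q *m Q^T = 1%:M, forall i, 0 <= l i, forall i : 'I_d, (k <= i)%N -> l i = 0 &
   forall v : 'rV[R]_d,
     \sum_i ((v *m Q) *m a) 0 i ^+ 2 = \sum_i l i * v 0 i ^+ 2].
Proof.
have [Q [D [QQ QD]]] := @symmetric_diagonalizable R d (a *m a^T)
  ltac:(by rewrite trmx_mul trmxK).
have [s sP] := perm_to_front [set i | D 0 i != 0].
pose P : 'M[R]_d := perm_mx s.
have PP : P *m P^T = 1%:M by rewrite /P tr_perm_mx -perm_mxM mulgV perm_mx1.
have rk : (#|[set i | (D 0 i != 0)%R]| <= k)%N.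
  apply: leq_trans (card_diag_mx_rank D) _; rewrite -QD.
  apply: leq_trans (mxrankM_maxl _ _) _; apply: leq_trans (mxrankM_maxr _ _) _.
  exact: leq_trans (mxrankM_maxl _ _) (rank_leq_col _).
exists (P *m Q), (fun i => D 0 (s i)); split.
- by rewrite trmx_mul mulmxA -(mulmxA P) QQ mulmx1.
- move=> i; set j := s i.
  have <- : (Q *m (a *m a^T) *m Q^T) j j = D 0 j by rewrite QD mxE eqxx mulr1n.
  have -> : Q *m (a *m a^T) *m Q^T = (Q *m a) *m (Q *m a)^T.
    by rewrite trmx_mul !mulmxA.
  by rewrite mxE sumr_ge0 // => m _; rewrite [X in _ * X]mxE sqr_ge0.
- move=> i ki; apply/eqP; apply: contraLR ki => Dn0.
  by rewrite -ltnNge (leq_trans _ rk) // sP // inE.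
move=> v.
have E (u : 'rV[R]_k) : \sum_i u 0 i ^+ 2 = (u *m u^T) 0 0.
  by rewrite mulmx_trE.
rewrite E.
have -> : v *m (P *m Q) *m a *m (v *m (P *m Q) *m a)^T =
  v *m P *m diag_mx D *m (v *m P)^T by rewrite -QD !trmx_mul !mulmxA.
rewrite mul_mx_diag mxE (reindex_inj (@perm_inj _ s)) /=.
have vP i : (v *m P) 0 (s i) = v 0 i.
  by rewrite /P -[s in perm_mx s]invgK -col_permE mxE permK.
by apply: eq_bigr => i _; rewrite mxE [X in _ * X]mxE vP mulrAC mulrC.
Qed.

(** * Tilted product measures on the sign cube *)

Section tilted_signs.
Variables (R : realFieldType) (I : finType) (s : I -> R).
Hypothesis s_le1 : forall i, `|s i| <= 1.

(** The product probability on the cube under which the signs [(-1) ^+ f i] are independent with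
    means [s i]. *)
Definition tilt (f : {ffun I -> bool}) : R :=
  \prod_i ((1 + s i * (-1) ^+ f i) / 2).

Lemma tilt_ge0 f : 0 <= tilt f.
Proof.
apply: prodr_ge0 => i _; rewrite divr_ge0 //.
by have := s_le1 i; rewrite ler_norml => /andP[? ?]; case: (f i); rewrite ?expr1 ?expr0; lra.
Qed.

Lemma tilt_expect (A : {set I}) :
  \sum_f tilt f * \prod_(i in A) (-1) ^+ f i = \prod_(i in A) s i.
Proof.
pose G i (c : bool) : R :=
  (1 + s i * (-1) ^+ c) / 2 * (if i \in A then (-1) ^+ c else 1).
transitivity (\sum_(f : {ffun I -> bool}) \prod_i G i (f i)).
  by apply: eq_bigr => f _; rewrite big_split -big_mkcond.
rewrite -bigA_distr_bigA [RHS]big_mkcond; apply: eq_bigr => i _.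
by rewrite big_bool /G /= expr1 expr0; case: ifP => _; field.
Qed.

Lemma tilt_sum1 : \sum_f tilt f = 1.
Proof.
have := tilt_expect finset.set0; rewrite big_set0 => <-.
by apply: eq_bigr => f _; rewrite big_set0 mulr1.
Qed.

(** Multiplied by [2 ^+ #|I|], this is the second moment of the density of the tilted law with
    respect to the uniform one: the price of the change of measure. *)
Lemma tilt_sum_sqr : \sum_f tilt f ^+ 2 = \prod_i ((1 + s i ^+ 2) / 2).
Proof.
pose G i (c : bool) : R := ((1 + s i * (-1) ^+ c) / 2) ^+ 2.
transitivity (\sum_(f : {ffun I -> bool}) \prod_i G i (f i)).
  by apply: eq_bigr => f _; rewrite -prodrXl.
rewrite -bigA_distr_bigA; apply: eq_bigr => i _.
by rewrite big_bool /G /= expr1 expr0; field.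
Qed.

Variable b : I -> R.
Let S (f : {ffun I -> bool}) := \sum_i (-1) ^+ f i * b i.
Let m := \sum_i s i * b i.

Lemma tilt_mean : \sum_f tilt f * S f = m.
Proof.
under eq_bigr do rewrite mulr_sumr.
rewrite exchange_big; apply: eq_bigr => i _.
under eq_bigr do rewrite mulrA.
rewrite -mulr_suml; congr (_ * _).
have := tilt_expect [set i]; rewrite big_set1 => <-.
by apply: eq_bigr => f _; rewrite big_set1.
Qed.

Lemma tilt_corr i j : \sum_f tilt f * ((-1) ^+ f i * (-1) ^+ f j) =
  s i * s j + (i == j)%:R * (1 - s i ^+ 2).
Proof.
have [<-|ij] := eqVneq i j.
  under eq_bigr do rewrite -expr2 sqrr_sign mulr1.
  by rewrite tilt_sum1 mul1r; ring.
have jS : i \notin [set j] by rewrite inE.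
have := tilt_expect (i |: [set j]); rewrite big_setU1 // big_set1 /= => E.
rewrite mul0r addr0 -E; apply: eq_bigr => f _.
by rewrite big_setU1 // big_set1.
Qed.

(** By independence the variance of [S] is the sum of the [(1 - s i ^+ 2) * b i ^+ 2]. *)
Lemma tilt_second_moment : \sum_f tilt f * S f ^+ 2 <= m ^+ 2 + \sum_i b i ^+ 2.
Proof.
have -> : \sum_f tilt f * S f ^+ 2 =
    \sum_i \sum_j b i * b j * (s i * s j + (i == j)%:R * (1 - s i ^+ 2)).
  under [RHS]eq_bigr do under eq_bigr do rewrite -tilt_corr mulr_sumr.
  under [RHS]eq_bigr do rewrite exchange_big.
  rewrite [RHS]exchange_big /=; apply: eq_bigr => f _.
  rewrite expr2 {1}/S big_distrl /= mulr_sumr; apply: eq_bigr => i _.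
  by rewrite !mulr_sumr; apply: eq_bigr => j _; ring.
rewrite expr2 {1}/m big_distrl -big_split /=; apply: ler_sum => i _.
under eq_bigr do rewrite mulrDr; rewrite big_split /= lerD //.
  by rewrite /m mulr_sumr; apply: ler_sum => j _; rewrite le_eqVlt; apply/orP; left; apply/eqP; ring.
rewrite (bigD1 i) //= eqxx big1 => [|j /negPf ji].
  by rewrite mul1r; have := sqr_ge0 (b i * s i); rewrite exprMn; lra.
by rewrite eq_sym ji mul0r mulr0.
Qed.

(* A Paley-Zygmund bound for the tilted measure, then Cauchy-Schwarz to return to
   the uniform one; both are used in the pointwise form [2xy <= x^2 + y^2]. *)
Lemma tilt_count : 0 < m -> \sum_i b i ^+ 2 <= m ^+ 2 ->
  2 ^+ #|I| <= 64 * \prod_i (1 + s i ^+ 2) * #|[set f | m / 2 < S f]|%:R.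
Proof.
move=> m0 Vm; pose W := \sum_f tilt f ^+ 2.
have WE : W = \prod_i (1 + s i ^+ 2) / 2 ^+ #|I|.
  by rewrite /W tilt_sum_sqr prodf_div prodr_const.
have P0 : 0 < \prod_i (1 + s i ^+ 2).
  by apply: prodr_gt0 => i _; rewrite ltr_pwDl // sqr_ge0.
have W0 : 0 < W by rewrite WE divr_gt0 // exprn_gt0.
set A := [set f | _]; set N := #|A|%:R.
have m8 : 0 <= (8 * m)^-1 by rewrite invr_ge0 ltW // mulr_gt0.
have W16 : 0 <= (16 * W)^-1 by rewrite invr_ge0 ltW // mulr_gt0.
(* Where [S f <= m / 2] the first term suffices; elsewhere both factors are split by
   [2xy <= x^2 + y^2]. After summation the right-hand side is at most [m/2 + m/4 + m/8 + 8 m W N],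
   so [1 <= 64 W N]. *)
have pw f : tilt f * S f <= (m / 2) * tilt f + (8 * m)^-1 * (tilt f * S f ^+ 2)
    + 2 * m * ((16 * W)^-1 * tilt f ^+ 2 + (f \in A)%:R * (4 * W)).
  have t0 := tilt_ge0 f.
  have q0 : 0 <= (8 * m)^-1 * (tilt f * S f ^+ 2).
    by rewrite (mulr_ge0 m8) // mulr_ge0 // sqr_ge0.
  have w0 : 0 <= (16 * W)^-1 * tilt f ^+ 2.
    by rewrite mulr_ge0 ?sqr_ge0.
  rewrite inE; case: ltP => Sm.
    have h1 : S f <= (8 * m)^-1 * S f ^+ 2 + 2 * m.
      rewrite -subr_ge0.
      have -> : (8 * m)^-1 * S f ^+ 2 + 2 * m - S f = (8 * m)^-1 * (S f - 4 * m) ^+ 2.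
        by field; rewrite gt_eqF.
      by rewrite mulr_ge0 ?sqr_ge0.
    have h2 : tilt f <= (16 * W)^-1 * tilt f ^+ 2 + 4 * W.
      rewrite -subr_ge0.
      have -> : (16 * W)^-1 * tilt f ^+ 2 + 4 * W - tilt f =
        (16 * W)^-1 * (tilt f - 8 * W) ^+ 2 by field; rewrite gt_eqF.
      by rewrite mulr_ge0 ?sqr_ge0.
    have := ler_wpM2l t0 h1.
    have := ler_wpM2l (ltW m0) h2.
    have := mulr_ge0 (ltW m0) t0.
    rewrite mul1r; set x := (8 * m)^-1; set y := (16 * W)^-1 * _; nra.
  have := ler_wpM2l t0 Sm; rewrite mul0r addr0.
  have := mulr_ge0 (ltW m0) w0; nra.
have := ler_sum (P := predT) _ (fun f _ => pw f).
move=> /(_ (index_enum _)).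
rewrite !big_split /= -!mulr_sumr big_split /= -!mulr_sumr -mulr_suml.
rewrite tilt_mean tilt_sum1 -/W mulr1.
have -> : \sum_f (f \in A)%:R = N :> R.
  by rewrite -natr_sum -big_mkcond sum1_card.
have : (8 * m)^-1 * \sum_f tilt f * S f ^+ 2 <= m / 4.
  have := tilt_second_moment; move: (\sum_f _) => X hX.
  rewrite mulrC ler_pdivrMr ?mulr_gt0 //; nra.
have -> : (16 * W)^-1 * W = 16^-1 by field; rewrite gt_eqF.
move: ((8 * m)^-1 * _) => X hX hm.
have h : 1 <= 64 * W * N.
  by rewrite -(ler_pM2l m0); nra.
have : 2 ^+ #|I| * 1 <= 2 ^+ #|I| * (64 * W * N) by rewrite ler_pM2l // exprn_gt0.
rewrite mulr1; congr (_ <= _).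
by rewrite WE; field; rewrite expf_neq0.
Qed.

End tilted_signs.

(* The tilt [s] is at least [32 eps] in absolute value, so that the mean exceeds
   [2 eps], and at least [|b i|] over the l2 norm of [b], so that the mean also
   dominates the standard deviation even when [b] is concentrated on few indices. *)
Lemma sign_sum_tail (R : realType) (I : finType) (b : I -> R) (eps : R) :
  0 < eps -> eps < 32^-1 -> 16^-1 <= \sum_i `|b i| ->
  2 ^+ #|I| <= 64 * expR (1024 * #|I|%:R * eps ^+ 2 + 1) *
    #|[set f : {ffun I -> bool} | eps < \sum_i (-1) ^+ f i * b i]|%:R.
Proof.
move=> e0 e32 bB; pose V := \sum_i b i ^+ 2; pose q := Num.sqrt V.
have V_ge0 : 0 <= V by apply: sumr_ge0 => i _; exact: sqr_ge0.
have V0 : 0 < V.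
  rewrite lt_neqAle V_ge0 andbT eq_sym psumr_eq0 => [|i _]; last exact: sqr_ge0.
  apply/negP => /allP bz; move: bB; rewrite big1 => [|i _]; first by rewrite lt_geF.
  have /implyP/(_ isT) := bz i (mem_index_enum i).
  by rewrite sqrf_eq0 => /eqP ->; rewrite normr0.
have q0 : 0 < q by rewrite sqrtr_gt0.
have qq : q ^+ 2 = V by rewrite sqr_sqrtr.
have bq i : `|b i| <= q.
  rewrite -(ler_pXn2r (n := 2)) ?nnegrE // ?(ltW q0) // qq /V (bigD1 i) //=.
  by rewrite real_normK ?num_real // lerDl sumr_ge0 // => j _; exact: sqr_ge0.
pose t i := Num.max (32 * eps) (`|b i| / q); pose s i := Num.sg (b i) * t i.
have t0 i : 0 <= t i by rewrite le_max mulr_ge0 // ltW.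
have t1 i : t i <= 1 by rewrite ge_max ler_pdivrMr // mul1r bq andbT; lra.
have sg1 i : `|Num.sg (b i)| <= 1 by rewrite normr_sg; case: (_ != 0).
have s1 i : `|s i| <= 1.
  by rewrite normrM (ger0_norm (t0 i)) mulr_ile1.
have sb i : s i * b i = t i * `|b i| by rewrite normrEsg /s; ring.
(* [32 eps] times the lower bound [1/16] gives [2 eps], so the threshold [m / 2] of [tilt_count] is
   at least [eps]. *)
have m1 : 2 * eps <= \sum_i s i * b i.
  apply: (@le_trans _ _ (\sum_i 32 * eps * `|b i|)).
    rewrite -mulr_sumr; have := ler_wpM2l (ltW e0) bB; lra.
  by apply: ler_sum => i _; rewrite sb ler_wpM2r // le_max lexx.
have m2 : q <= \sum_i s i * b i.
  apply: (@le_trans _ _ (\sum_i `|b i| / q * `|b i|)).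
    rewrite le_eqVlt; apply/orP; left; apply/eqP.
    transitivity (V / q); first by rewrite -qq expr2 mulfK // gt_eqF.
    rewrite /V mulr_suml; apply: eq_bigr => i _.
    by rewrite [RHS]mulrAC -expr2 real_normK // num_real.
  by apply: ler_sum => i _; rewrite sb ler_wpM2r // le_max lexx orbT.
have Vm : V <= (\sum_i s i * b i) ^+ 2.
  by rewrite -qq ler_pXn2r ?nnegrE // ?(le_trans _ m2) // ltW.
have := tilt_count s1 (lt_le_trans q0 m2) Vm.
move=> /le_trans; apply; apply: ler_pM.
- by rewrite mulr_ge0 // prodr_ge0 // => i _; rewrite addr_ge0 // sqr_ge0.
- by [].
- rewrite ler_pM2l //.
  apply: (@le_trans _ _ (\prod_i expR (s i ^+ 2))).
    by apply: ler_prod => i _; rewrite addr_ge0 ?sqr_ge0 //= expR_ge1Dx.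
  rewrite -expR_sum ler_expR.
  (* The square of the maximum is at most the sum of the two squares. Summing over [i], the first
     squares give [1024 #|I| eps^2] and the second ones give exactly [1]. *)
  apply: (@le_trans _ _ (\sum_i ((32 * eps) ^+ 2 + b i ^+ 2 / V))).
    apply: ler_sum => i _.
    have -> : b i ^+ 2 / V = (`|b i| / q) ^+ 2.
      by rewrite expr_div_n qq real_normK // num_real.
    apply: (@le_trans _ _ (t i ^+ 2)).
      rewrite /s exprMn -real_normK ?num_real // ler_piMl ?sqr_ge0 //.
      by rewrite exprn_ile1.
    rewrite /t maxEle; case: ifP => _; first by rewrite lerDr sqr_ge0.
    by rewrite lerDl sqr_ge0.
  rewrite big_split /= sumr_const -mulr_suml divff ?gt_eqF //.
  by rewrite lerD2r -mulr_natr exprMn; lra.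
- rewrite ler_nat; apply/subset_leq_card/fintype.subsetP => f; rewrite !inE.
  by apply: le_lt_trans; lra.
Qed.

(** * Orthogonal maps acting on pairs of coordinates *)

Section paired_coordinates.
Variables (R : realType) (d k : nat) (p q : 'I_k -> 'I_d).
Hypotheses (p_inj : injective p) (q_inj : injective q).
Hypothesis pq : forall i j, p i != q j.

(** The rows are pairwise orthogonal with squared norm [5], so [pair_reflection] is the product of
    the commuting reflections along them. The triple 3, 4, 5 keeps all coefficients rational. *)
Let W : 'M[R]_(k, d) := \matrix_(i, j) (2 * (q i == j)%:R - (p i == j)%:R).

Let mulW (v : 'rV[R]_d) i : (v *m W^T) 0 i = 2 * v 0 (q i) - v 0 (p i).
Proof.
rewrite mxE (bigD1 (q i)) //= (bigD1 (p i)) //= big1 => [|j /andP[jq jp]].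
  rewrite !mxE !eqxx [q i == _]eq_sym !(negPf (pq _ _)) /=; ring.
by rewrite !mxE ![_ == j]eq_sym (negPf jq) (negPf jp) mulr0 subr0 mulr0.
Qed.

Let mulp (u : 'rV[R]_k) i : (u *m W) 0 (p i) = - u 0 i.
Proof.
rewrite mxE (bigD1 i) //= big1 => [|j ji].
  rewrite !mxE eqxx [q i == _]eq_sym (negPf (pq _ _)) /=; ring.
by rewrite !mxE (inj_eq p_inj) (negPf ji) [q j == _]eq_sym (negPf (pq _ _)) mulr0 subr0 mulr0.
Qed.

Let mulq (u : 'rV[R]_k) i : (u *m W) 0 (q i) = 2 * u 0 i.
Proof.
rewrite mxE (bigD1 i) //= big1 => [|j ji].
  rewrite !mxE eqxx (negPf (pq _ _)) /=; ring.
by rewrite !mxE (inj_eq q_inj) (negPf ji) (negPf (pq _ _)) mulr0 subr0 mulr0.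
Qed.

Definition pair_reflection : 'M[R]_d := 1%:M - (2 / 5) *: (W^T *m W).

Lemma pair_reflection_orthogonal : orthogonal_mx pair_reflection.
Proof.
have WW : W *m W^T = 5%:M.
  apply/row_matrixP => i; apply/rowP => j.
  rewrite row_mul [LHS]mulW !mxE !(inj_eq p_inj) !(inj_eq q_inj).
  rewrite (negPf (pq _ _)) [q i == _]eq_sym (negPf (pq _ _)).
  by case: eqP => _ /=; ring.
rewrite /orthogonal_mx /pair_reflection; set P := W^T *m W.
have PP : P *m P = 5 *: P.
  by rewrite /P mulmxA -(mulmxA W^T) WW mul_mx_scalar -scalemxAl.
have PT : P^T = P by rewrite /P trmx_mul trmxK.
have -> : (1%:M - (2 / 5) *: P)^T = 1%:M - (2 / 5) *: P.
  by rewrite linearB /= trmx1 [X in _ - X]linearZ /= PT.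
rewrite mulmxBl mul1mx mulmxBr mulmx1 -scalemxAl -scalemxAr PP !scalerA.
rewrite -scalerBl -addrA -opprD -scalerDl.
have -> : 2 / 5 + (2 / 5 - 2 / 5 * (2 / 5) * 5) = 0 :> R by field.
by rewrite scale0r subr0.
Qed.

Lemma pair_reflectionp (v : 'rV[R]_d) i :
  (v *m pair_reflection) 0 (p i) = (3 * v 0 (p i) + 4 * v 0 (q i)) / 5.
Proof.
rewrite mulmxBr mulmx1 -scalemxAr mulmxA mxE [X in _ + X]mxE [X in - X]mxE.
by rewrite mulp mulW; field.
Qed.

Lemma pair_reflectionq (v : 'rV[R]_d) i :
  (v *m pair_reflection) 0 (q i) = (4 * v 0 (p i) - 3 * v 0 (q i)) / 5.
Proof.
rewrite mulmxBr mulmx1 -scalemxAr mulmxA mxE [X in _ + X]mxE [X in - X]mxE.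
by rewrite mulq mulW; field.
Qed.

(** Since [q] is injective, at most one index [i] contributes to the product at [j]; this form
    avoids inverting [q]. *)
Definition flip_signs (f : {ffun 'I_k -> bool}) : 'M[R]_d :=
  diag_mx (\row_j \prod_i (-1) ^+ ((q i == j) && f i)).

Lemma flip_signs_orthogonal f : orthogonal_mx (flip_signs f).
Proof.
rewrite /orthogonal_mx /flip_signs tr_diag_mx mulmx_diag.
apply/matrixP => i j; rewrite !mxE -big_split /=.
by rewrite big1 // => m _; rewrite -expr2 sqrr_sign.
Qed.

Lemma flip_signsp f (v : 'rV[R]_d) i : (v *m flip_signs f) 0 (p i) = v 0 (p i).
Proof.
rewrite mul_mx_diag !mxE big1 ?mulr1 // => j _.
by rewrite eq_sym (negPf (pq _ _)).
Qed.

Lemma flip_signsq f (v : 'rV[R]_d) i :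
  (v *m flip_signs f) 0 (q i) = (-1) ^+ f i * v 0 (q i).
Proof.
rewrite mul_mx_diag !mxE (bigD1 i) //= big1 => [|j ji].
  by rewrite eqxx mulr1 mulrC.
by rewrite (inj_eq q_inj) (negPf ji).
Qed.
End paired_coordinates.

(** * Averaging over events and counting favourable signs *)

(** Double counting: integrate the pointwise bound of [N] times the indicator of [G] by the sum of
    the indicators of the [B j]. *)
Lemma sum_measure_ge (R : realType) (disp : measure_display) (T : measurableType disp)
    (mu : {measure set T -> \bar R}) (J : finType) (B : J -> set T) (G : set T) (N : R) :
  0 <= N -> (forall j, measurable (B j)) -> measurable G ->
  (forall v, G v -> N <= \sum_j \1_(B j) v) ->
  (N%:E * mu G <= \sum_j mu (B j))%E.
Proof.
move=> N0 mB mG GN.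
have -> : (\sum_j mu (B j) = \int[mu]_v (\sum_j (\1_(B j) v)%:E))%E.
  rewrite ge0_integral_sum //.
  - by apply: eq_bigr => j _; rewrite integral_indic // setIT.
  - by move=> j; apply/measurable_EFinP; exact: measurable_indic.
have -> : (N%:E * mu G = \int[mu]_v (N%:E * (\1_G v)%:E))%E.
  rewrite ge0_integralZl_EFin //.
  - by rewrite integral_indic // setIT.
  - by apply/measurable_EFinP; exact: measurable_indic.
apply: ge0_le_integral => //.
- by move=> v _; rewrite -EFinM lee_fin mulr_ge0.
- by apply/measurable_EFinP; apply: measurable_funM => //; exact: measurable_indic.
- apply: emeasurable_sum => j; apply/measurable_EFinP; exact: measurable_indic.
move=> v _; rewrite sumEFin -EFinM lee_fin.
have [Gv|nGv] := pselect (G v).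
  by rewrite indicE mem_set // mulr1 GN.
by rewrite indicE memNset // mulr0 sumr_ge0.
Qed.

Local Open Scope classical_set_scope.
Local Open Scope ring_scope.

Lemma deviation_count (R : realType) (I : finType) (lam x y : I -> R) (eps : R) :
  (forall i, 0 <= lam i) -> 0 < eps -> eps < 32^-1 ->
  3 / 28 * \sum_i lam i * (x i ^+ 2 + y i ^+ 2) <= \sum_i lam i * `|x i * y i| ->
  2 ^+ #|I| <= 64 * expR (1024 * #|I|%:R * eps ^+ 2 + 1) *
    #|[set f : {ffun I -> bool} | (eps <
      `|\sum_i lam i * ((3 * x i + 4 * ((-1) ^+ f i * y i)) / 5) ^+ 2 - 1|)%R]%SET|%:R.
Proof.
move=> lam0 e0 e32 hr; set r2 := \sum_i _ in hr.
set Y := fun f : {ffun I -> bool} => \sum_i lam i * ((3 * x i + 4 * ((-1) ^+ f i * y i)) / 5) ^+ 2.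
rewrite -/(Y _).
pose M := \sum_i lam i * (9 * x i ^+ 2 + 16 * y i ^+ 2) / 25.
pose b i := 24 / 25 * (lam i * (x i * y i)).
have YE f : Y f = M + \sum_i (-1) ^+ f i * b i.
  rewrite /Y /M -big_split /=; apply: eq_bigr => i _; rewrite /b.
  by case: (f i); rewrite ?expr1 ?expr0; field.
have Yr2 f : Y f <= r2.
  apply: ler_sum => i _; apply: ler_wpM2l => //.
  rewrite -subr_ge0; set c := (-1) ^+ f i.
  have -> : x i ^+ 2 + y i ^+ 2 - ((3 * x i + 4 * (c * y i)) / 5) ^+ 2 =
      ((4 * x i - 3 * (c * y i)) / 5) ^+ 2 + (1 - c ^+ 2) * y i ^+ 2 by field.
  by rewrite sqrr_sign subrr mul0r addr0 sqr_ge0.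
have count (P : pred {ffun I -> bool}) :
    {subset P <= [pred f | eps < `|Y f - 1|]} ->
    2 ^+ #|I| <= 64 * expR (1024 * #|I|%:R * eps ^+ 2 + 1) * #|P|%:R ->
    2 ^+ #|I| <= 64 * expR (1024 * #|I|%:R * eps ^+ 2 + 1) *
      #|[set f : {ffun I -> bool} | (eps < `|Y f - 1|)%R]%SET|%:R.
  move=> sP /le_trans; apply; rewrite ler_wpM2l ?mulr_ge0 ?expR_ge0 //.
  rewrite ler_nat; apply/subset_leq_card/fintype.subsetP => f /sP.
  by rewrite !inE.
(* Below [15/16], every sign pattern gives [1 - Y f > 1/16 > eps]. *)
have [rs|rl] := ltP r2 (15 / 16).
  apply: (count predT) => [f _|].
    by rewrite inE lter_normr; apply/orP; right; have := Yr2 f; lra.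
  rewrite cardT -cardE card_ffun card_bool natrX ler_peMl ?exprn_ge0 //.
  set z := 1024 * _ * _; have z0 : 0 <= z.
    exact: mulr_ge0 (mulr_ge0 (ler0n _ _) (ler0n _ _)) (sqr_ge0 _).
  have := expR_ge1Dx (z + 1); lra.
(* The constants leave room: [24/25 * 3/28 * 15/16] exceeds [1/16]. *)
have bB : 16^-1 <= \sum_i `|b i|.
  have -> : \sum_i `|b i| = 24 / 25 * \sum_i lam i * `|x i * y i|.
    rewrite mulr_sumr; apply: eq_bigr => i _.
    by rewrite /b normrM (@ger0_norm _ (24 / 25)) ?divr_ge0 // normrM (ger0_norm (lam0 i)).
  lra.
(* The signed sum is pushed away from [1]: upwards when [M >= 1], and downwards otherwise, by
   applying the tail bound to [- b]. *)
have [M1|M1] := leP 1 M.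
  apply: (count _ _ (sign_sum_tail e0 e32 bB)) => f; rewrite !inE => h.
  by rewrite lter_normr YE; apply/orP; left; lra.
have bB' : 16^-1 <= \sum_i `|- b i| by under eq_bigr do rewrite normrN.
apply: (count _ _ (sign_sum_tail e0 e32 bB')) => f; rewrite !inE.
under eq_bigr do rewrite mulrN; rewrite sumrN => h.
by rewrite lter_normr YE; apply/orP; right; lra.
Qed.

(** * Continuity and Borel measurability of the events *)

Lemma open_borel_measurable (R : realType) d (B : set 'rV[R]_d) :
  open B -> measurable (B : set (borel_rV R d)).
Proof. exact: sub_sigma_algebra. Qed.

Lemma continuous_sum (R : realType) (T : topologicalType) (I : finType)
    (F : I -> T -> R) :
  (forall i, continuous (F i)) -> continuous (fun v => \sum_i F i v).
Proof. by move=> cF; apply: continuous_big => //; exact: add_continuous. Qed.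

Lemma mulmx_coord_continuous (R : realType) d m (Q : 'M[R]_(d, m)) j :
  continuous (fun v : 'rV[R]_d => (v *m Q) 0 j).
Proof.
have -> : (fun v : 'rV[R]_d => (v *m Q) 0 j) = fun v => \sum_i v 0 i * Q i j.
  by apply/funext => v; rewrite mxE.
apply: continuous_sum => i v; apply: continuousM; last exact: cst_continuous.
exact: coord_continuous.
Qed.

Lemma continuous_ltr_open (R : realType) (T : topologicalType) (f g : T -> R) :
  continuous f -> continuous g -> open [set v | f v < g v].
Proof.
move=> cf cg.
have -> : [set v | f v < g v] = (fun v => g v - f v) @^-1` [set x | 0 < x].
  by apply/seteqP; split=> v /=; rewrite subr_gt0.
apply: open_comp; last exact: open_gt.
by move=> v _; apply: continuousB; [exact: cg|exact: cf].
Qed.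

Lemma quadratic_continuous (R : realType) d (I : finType) m (Q : 'M[R]_(d, m))
    (lam : I -> R) (p : I -> 'I_m) :
  continuous (fun v : 'rV[R]_d => \sum_i lam i * (v *m Q) 0 (p i) ^+ 2).
Proof.
apply: continuous_sum => i v.
have cQ := @mulmx_coord_continuous R d m Q (p i) v.
have cl : {for v, continuous (fun=> lam i : R)} by exact: cst_continuous.
exact: (continuousM cl (continuousM cQ cQ)).
Qed.

Lemma continuous_normr (R : realType) (T : topologicalType) (f : T -> R) v :
  {for v, continuous f} -> {for v, continuous (fun v => `|f v|)}.
Proof. exact: cvg_norm. Qed.

(** * Deviation under an orthogonally invariant law *)

Section invariant_measure.
Variables (R : realType) (d k : nat) (p q : 'I_k -> 'I_d) (lam : 'I_k -> R).
Hypotheses (p_inj : injective p) (q_inj : injective q).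
Hypothesis pq : forall i j, p i != q j.
Hypothesis lam_ge0 : forall i, 0 <= lam i.
Variable mu : probability (borel_rV R d) R.
Hypothesis mu_inv : forall Q : 'M[R]_d, orthogonal_mx Q ->
  forall B : set 'rV[R]_d, measurable (B : set (borel_rV R d)) ->
    mu ((fun v : 'rV[R]_d => v *m Q) @^-1` B) = mu B.

Let O : 'M[R]_d := pair_reflection R p q.

(** Here and in [spread], the event for an orthogonal [Q] is the preimage of the event for [1%:M]
    under [v |-> v *m Q], so invariance gives both the same measure. *)
Let deviation eps (Q : 'M[R]_d) : set 'rV[R]_d :=
  [set v | eps < `|\sum_i lam i * (v *m Q) 0 (p i) ^+ 2 - 1|].

Let spread (Q : 'M[R]_d) : set 'rV[R]_d :=
  [set v | 3 / 28 * \sum_i lam i * ((v *m Q) 0 (p i) ^+ 2 + (v *m Q) 0 (q i) ^+ 2)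
    <= \sum_i lam i * `|(v *m Q) 0 (p i) * (v *m Q) 0 (q i)|].

Let deviation_measurable eps Q :
  measurable (deviation eps Q : set (borel_rV R d)).
Proof.
apply: open_borel_measurable; apply: continuous_ltr_open.
  by move=> v; exact: cst_continuous.
move=> v; have c1 : {for v, continuous (fun=> 1 : R)} by exact: cst_continuous.
have cF := @quadratic_continuous R d _ d Q lam p v.
exact: (continuous_normr (continuousB cF c1)).
Qed.

Let spread_measurable Q : measurable (spread Q : set (borel_rV R d)).
Proof.
have -> : spread Q = ~` [set v |
    \sum_i lam i * `|(v *m Q) 0 (p i) * (v *m Q) 0 (q i)| <
    3 / 28 * \sum_i lam i * ((v *m Q) 0 (p i) ^+ 2 + (v *m Q) 0 (q i) ^+ 2)].
  apply/seteqP; split=> v; rewrite /spread /=.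
    by move=> /le_gtF ->.
  by move=> /negP; rewrite -leNgt.
apply: measurableC; apply: open_borel_measurable; apply: continuous_ltr_open.
  apply: continuous_sum => i v.
  have cp := @mulmx_coord_continuous R d d Q (p i) v.
  have cq := @mulmx_coord_continuous R d d Q (q i) v.
  have cl : {for v, continuous (fun=> lam i : R)} by exact: cst_continuous.
  exact: (continuousM cl (continuous_normr (continuousM cp cq))).
move=> v; have cc : {for v, continuous (fun=> 3 / 28 : R)} by exact: cst_continuous.
pose F i (w : 'rV[R]_d) :=
  lam i * ((w *m Q) 0 (p i) ^+ 2 + (w *m Q) 0 (q i) ^+ 2).
suff cF : continuous (fun w => \sum_i F i w) by exact: (continuousM cc (cF v)).
apply: continuous_sum => i w; rewrite /F.
have cp := @mulmx_coord_continuous R d d Q (p i) w.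
have cq := @mulmx_coord_continuous R d d Q (q i) w.
have cl : {for w, continuous (fun=> lam i : R)} by exact: cst_continuous.
exact: (continuousM cl (continuousD (continuousM cp cp) (continuousM cq cq))).
Qed.

(* The reflection turns [x y] into [(3x + 4y)(4x - 3y) / 25], and the two products
   cannot both be small compared with [x^2 + y^2]. *)
Let spread_cover : [set: 'rV[R]_d] `<=` spread 1%:M `|` spread O.
Proof.
move=> v _ /=; rewrite /spread /= mulmx1.
set x := fun i => v 0 (p i); set y := fun i => v 0 (q i).
set r := \sum_i _ * _; set h := \sum_i _ * _; set r' := \sum_i _ * _; set h' := \sum_i _ * _.
have rr : r' = r.
  by apply: eq_bigr => i _; rewrite pair_reflectionp // pair_reflectionq //; field.
have : r <= 14 / 3 * (h + h').
  rewrite /h /h' -big_split mulr_sumr; apply: ler_sum => i _ /=.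
  rewrite pair_reflectionp // pair_reflectionq // -mulrDr mulrCA.
  apply: ler_wpM2l => //; rewrite -/(x i) -/(y i).
  set X := x i; set Y := y i.
  have -> : (3 * X + 4 * Y) / 5 * ((4 * X - 3 * Y) / 5) =
     (12 * (X ^+ 2 - Y ^+ 2) + 7 * (X * Y)) / 25 by field.
  set a := `|X * Y|; set b := `|_ / 25|.
  have a1 : X * Y <= a by exact: ler_norm.
  have a2 : - (X * Y) <= a by rewrite /a -normrN ler_norm.
  have b1 : (12 * (X ^+ 2 - Y ^+ 2) + 7 * (X * Y)) / 25 <= b by exact: ler_norm.
  have b2 : - ((12 * (X ^+ 2 - Y ^+ 2) + 7 * (X * Y)) / 25) <= b.
    by rewrite /b -normrN ler_norm.
  (* This follows from [(X^2 + Y^2)^2 = (X^2 - Y^2)^2 + (2XY)^2]. Together with the next bound,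
     [X^2 + Y^2] is at most [31/12 a + 25/12 b], and both coefficients are below [14/3]. *)
  have s : X ^+ 2 + Y ^+ 2 <= `|X ^+ 2 - Y ^+ 2| + 2 * a.
    have a0 : 0 <= a by exact: normr_ge0.
    have Da : 0 <= `|X ^+ 2 - Y ^+ 2| * a by rewrite mulr_ge0.
    have D2 : `|X ^+ 2 - Y ^+ 2| ^+ 2 = (X ^+ 2 - Y ^+ 2) ^+ 2.
      by rewrite real_normK ?num_real.
    have A2 : a ^+ 2 = (X * Y) ^+ 2 by rewrite real_normK ?num_real.
    rewrite -(@ler_pXn2r _ 2 isT) ?nnegrE; last 2 first.
    - by rewrite addr_ge0 ?sqr_ge0.
    - by rewrite addr_ge0 // mulr_ge0.
    by rewrite [leRHS]sqrrD D2 [(2 * a) ^+ 2]exprMn A2; lra.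
  have c : `|X ^+ 2 - Y ^+ 2| <= 25 / 12 * b + 7 / 12 * a.
    by rewrite ler_norml; apply/andP; split; lra.
  lra.
(* The larger of [h] and [h'] is at least half their sum, hence at least [3/28 r]. *)
by have [|] := leP (3 / 28 * r) h; [left|right; rewrite rr; lra].
Qed.

(** Two events of equal probability cover the space. *)
Let spread_ge_half : (2^-1%:E <= mu (spread 1%:M))%E.
Proof.
have OO : orthogonal_mx O by exact: pair_reflection_orthogonal.
have E : mu (spread O) = mu (spread 1%:M).
  rewrite -(mu_inv OO (spread_measurable 1%:M)); congr (mu _).
  by apply/seteqP; split=> v; rewrite /spread /= !mulmx1.
have : (mu [set: borel_rV R d] <= mu (spread 1%:M) + mu (spread O))%E.
  apply: (@le_trans _ _ (mu (spread 1%:M `|` spread O))); last exact: measureU2.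
  by apply: le_measure => //; rewrite inE //; exact: measurableU.
rewrite E probability_setT.
have /fineK <- : mu (spread 1%:M) \is a fin_num by exact: fin_num_measure.
by rewrite -EFinD !lee_fin; lra.
Qed.

(** The [2 ^+ k] events [deviation eps (Q f)] share one probability [beta], and at each point of
    [spread 1%:M] at least [N] of them occur. Averaging gives [N / 2 <= 2 ^+ k * beta]. *)
Lemma deviation_probability eps : 0 < eps -> eps < 32^-1 ->
  ((expR (- (1024 * (k%:R * eps ^+ 2 + 1))))%:E <=
    mu [set v : 'rV[R]_d | eps < `|\sum_i lam i * v 0 (p i) ^+ 2 - 1|]%R)%E.
Proof.
move=> e0 e32.
have -> : [set v : 'rV[R]_d | eps < `|\sum_i lam i * v 0 (p i) ^+ 2 - 1|] =
    deviation eps 1%:M.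
  by apply/seteqP; split=> v; rewrite /deviation /= mulmx1.
have OO : orthogonal_mx O by exact: pair_reflection_orthogonal.
(* On row vectors the flips act first, so coordinate [p i] becomes [(3 x + 4 e y) / 5] with [e] the
   sign of index [i]. *)
pose Q f := flip_signs R q f *m O.
have QO f : orthogonal_mx (Q f).
  rewrite /orthogonal_mx trmx_mul mulmxA -(mulmxA _ O) OO mulmx1.
  exact: flip_signs_orthogonal.
have E f : mu (deviation eps (Q f)) = mu (deviation eps 1%:M).
  rewrite -(mu_inv (QO f) (deviation_measurable eps 1%:M)); congr (mu _).
  by apply/seteqP; split=> v; rewrite /deviation /= mulmx1.
pose z := 1024 * k%:R * eps ^+ 2.
pose N := 2 ^+ k / (64 * expR (z + 1)).
have e1 : 0 < 64 * expR (z + 1) by rewrite mulr_gt0 // expR_gt0.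
have N0 : 0 <= N by rewrite divr_ge0 ?exprn_ge0 // ltW.
have cnt v : spread 1%:M v -> N <= \sum_f \1_(deviation eps (Q f)) v.
  rewrite /spread /= mulmx1 => vS.
  have := deviation_count lam_ge0 e0 e32 vS.
  set A := [set f | _]%SET => cA.
  have -> : \sum_f \1_(deviation eps (Q f)) v = #|A|%:R :> R.
    rewrite -sum1_card natr_sum [RHS]big_mkcond; apply: eq_bigr => f _.
    rewrite indicE /A inE.
    have EQ : \sum_i lam i * (v *m Q f) 0 (p i) ^+ 2 = \sum_i lam i *
        ((3 * v 0 (p i) + 4 * ((-1) ^+ f i * v 0 (q i))) / 5) ^+ 2.
      apply: eq_bigr => i _.
      by rewrite mulmxA pair_reflectionp // flip_signsp // flip_signsq.
    rewrite -EQ; set P := (_ < _)%R.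
    have -> : (v \in deviation eps (Q f)) = P by apply/idP/idP; rewrite inE.
    by case: ifP.
  rewrite /N ler_pdivrMr // mulrC; move: cA; rewrite card_ord; exact.
have : (N%:E * mu (spread 1%:M) <= \sum_f mu (deviation eps (Q f)))%E.
  by apply: sum_measure_ge => // f; exact: deviation_measurable.
rewrite (eq_bigr _ (fun f _ => E f)).
have := spread_ge_half.
have /fineK <- : mu (deviation eps 1%:M) \is a fin_num by exact: fin_num_measure.
have /fineK <- : mu (spread 1%:M) \is a fin_num by exact: fin_num_measure.
set beta := fine (mu (deviation _ _)); set g := fine (mu (spread _)).
rewrite -EFinM sumEFin !lee_fin sumr_const card_ffun card_bool card_ord => g2.
rewrite -[beta *+ _]mulr_natl natrX => NB.
have P0 : 0 < 2 ^+ k :> R by rewrite exprn_gt0.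
have b1 : (64 * expR (z + 1))^-1 / 2 <= beta.
  rewrite -(ler_pM2l P0); apply: le_trans NB; rewrite mulrA -/N.
  by rewrite ler_wpM2l.
apply: le_trans b1.
rewrite -invfM expRN lef_pV2 ?posrE ?expR_gt0 ?mulr_gt0 ?expR_gt0 //.
(* The remaining factor [64 * 2 = 128] is absorbed by [expR 1023 >= 1024]. *)
have -> : 1024 * (k%:R * eps ^+ 2 + 1) = (z + 1) + 1023 by rewrite /z; ring.
rewrite [leRHS]expRD; have := expR_ge1Dx (1023 : R); have := expR_gt0 (z + 1).
by move=> z0 h; rewrite -subr_ge0; nra.
Qed.

End invariant_measure.

(** * Reduction of a general linear map to weighted coordinates *)

Theorem theorem4 (R : realType) :
  exists eps0 C : R, 0 < eps0 /\ 0 < C /\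
  forall (k d : nat), (1 <= k)%N -> (2 * k < d)%N ->
  forall (A : {linear 'rV[R]_d -> 'rV[R]_k}) (eps : R),
    0 < eps -> eps < eps0 ->
  forall (disp : measure_display) (Omega : measurableType disp)
         (P : probability Omega R) (x : {RV P >-> borel_rV R d}),
    uniform_on_sphere (distribution P x) ->
    ((expR (- (C * (k%:R * eps ^+ 2 + 1))))%:E <=
      P [set w : Omega | eps < `| l2norm (A (x w)) ^+ 2 - 1 |]%R)%E.
Proof.
exists 32^-1, 1024; split; first by rewrite invr_gt0 ltr0n.
split; first by rewrite ltr0n.
move=> k d _ kd A eps e0 e32 disp Omega P x [_ mu_inv].
pose a := lin1_mx A.
have [Q [l [QQ l0 lk QE]]] := quadratic_form_diagonalizable a.
(* The first [k] coordinates carry the weights and the next [k] are their weightless partners;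
   [2 * k < d] leaves room for both. *)
have pk (i : 'I_k) : (i < d)%N.
  by rewrite (leq_trans (ltn_ord i)) // (leq_trans _ (ltnW kd)) // leq_pmull.
have qk (i : 'I_k) : (k + i < d)%N.
  by rewrite (leq_trans _ (ltnW kd)) // mul2n -addnn ltn_add2l.
pose p i := Ordinal (pk i); pose q i := Ordinal (qk i).
have p_inj : injective p by move=> i j [/val_inj].
have q_inj : injective q by move=> i j [/addnI /val_inj].
have pq i j : p i != q j by rewrite -val_eqE /= neq_ltn ltn_addr.
have QF (v : 'rV[R]_d) : \sum_i ((v *m Q) *m a) 0 i ^+ 2 = \sum_i l (p i) * v 0 (p i) ^+ 2.
  have dk : (k <= d)%N by rewrite (leq_trans _ (ltnW kd)) // leq_pmull.
  rewrite QE (bigID (fun j : 'I_d => (j < k)%N)) /= [X in _ + X]big1 ?addr0.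
    rewrite (big_ord_narrow dk) /=.
    by apply: eq_bigr => i _; rewrite (_ : widen_ord dk i = p i) //; apply: val_inj.
  by move=> j; rewrite -leqNgt => /lk ->; rewrite mul0r.
apply: le_trans (deviation_probability p_inj q_inj pq (fun i => l0 (p i)) mu_inv e0 e32) _.
pose B := [set v : 'rV[R]_d | eps < `|\sum_i (v *m a) 0 i ^+ 2 - 1|].
have mB : measurable (B : set (borel_rV R d)).
  apply: open_borel_measurable; apply: continuous_ltr_open.
    by move=> v; exact: cst_continuous.
  move=> v; have c1 : {for v, continuous (fun=> 1 : R)} by exact: cst_continuous.
  have cF := @quadratic_continuous R d _ k a (fun=> 1) id v.
  have -> : (fun v : 'rV[R]_d => `|\sum_i (v *m a) 0 i ^+ 2 - 1|) =
      (fun v => `|\sum_i 1 * (v *m a) 0 i ^+ 2 - 1|).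
    by apply/funext => w; under [in RHS]eq_bigr do rewrite mul1r.
  exact: (continuous_normr (continuousB cF c1)).
(* The weighted event is the preimage under [Q] of the event for [a], so invariance removes the
   change of coordinates. *)
rewrite (_ : [set v | _] = (fun v : 'rV[R]_d => v *m Q) @^-1` B); last first.
  by apply/seteqP; split=> v; rewrite /B /= QF.
rewrite mu_inv // /distribution /pushforward le_eqVlt; apply/orP; left; apply/eqP.
have nA v : l2norm (A v) ^+ 2 = \sum_i (v *m a) 0 i ^+ 2.
  rewrite /l2norm sqr_sqrtr; last by apply: sumr_ge0 => i _; exact: sqr_ge0.
  by rewrite mul_rV_lin1.
by congr (P _); apply/seteqP; split=> w; rewrite /B /= nA.
Qed.
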